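(* Let $V$ be a generalized complex vector space, let $W\subseteq V$ be an arbitrary real subspace, and let $\mathcal J_W$ be a generalized complex structure on $W$ such that $W$ satisfies the graph condition with respect to $\mathcal J_W$. If $W$ is a generalized complex subspace of $V$, then the graph condition is also satisfied with respect to the induced generalized complex structure on $W$, and $\mathcal J_W$ is a $\beta$-field transform of the induced structure on $W$.
   Context: All vector spaces are finite-dimensional. For a real vector space $V$, $V_{\mathbb C}$ is its complexification, with complex conjugation $x\mapsto\bar x$; for $U\subseteq V$, $\operatorname{Ann}(U)\subseteq V^*$ is the annihilator. On $V\oplus V^*$ (and its complexification) use the pairing $\langle v+f,w+g\rangle=-\tfrac12(f(w)+g(v))$. A generalized complex (GC) structure on $V$ is an $\mathbb R$-linear automorphism $\mathcal J$ of $V\oplus V^*$ that is orthogonal for $\langle\cdot,\cdot\rangle$ and satisfies $\mathcal J^2=-1$. Equivalently, it is a maximally isotropic complex subspace $E\subset V_{\mathbb C}\oplus V_{\mathbb C}^*$ with $E\cap\overline E=(0)$; $E$ is the $+i$-eigenspace of $\mathcal J$. Write $\mathcal J=\begin{pmatrix}\mathcal J_1&\mathcal J_2\\ \mathcal J_3&\mathcal J_4\end{pmatrix}$ with $\mathcal J_1:V\to V$, $\mathcal J_2:V^*\to V$, $\mathcal J_3:V\to V^*$, $\mathcal J_4:V^*\to V^*$. A GC vector space is a real vector space with a GC structure. GC subspace: for a real subspace $W\subseteq V$ put $E_W=\{(w,f|_{W_{\mathbb C}}) : (w,f)\in E\cap(W_{\mathbb C}\oplus V_{\mathbb C}^* )\}$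 (always a maximally isotropic subspace of $W_{\mathbb C}\oplus W_{\mathbb C}^*$). $W$ is a GC subspace if $E_W\cap\overline{E_W}=(0)$; then $E_W$ is the induced GC structure on $W$. $\beta$-field transform: for a real bivector $\beta\in\bigwedge^2 W$, viewed as a skew-symmetric linear map $W^*\to W$, the $\beta$-field transform of a GC structure $\mathcal J$ on $W$ is $\mathcal B'\mathcal J\mathcal B'^{-1}$ with $\mathcal B'=\begin{pmatrix}1&\beta\\0&1\end{pmatrix}$. Direct sum and twist: the direct sum of GC structures $\mathcal J_U$ on $U$ and $\mathcal J_V$ on $V$ is the structure on $U\oplus V$ given by $\mathcal J_U\oplus\mathcal J_V$ under the natural identification $(U\oplus V)\oplus(U\oplus V)^*\cong U\oplus U^*\oplus V\oplus V^*$. The twist of $\mathcal J$ is $\tilde{\mathcal J}=\begin{pmatrix}\mathcal J_1&-\mathcal J_2\\ -\mathcal J_3&\mathcal J_4\end{pmatrix}$. If $(W,\mathcal J_W)$, $(V,\mathcal J_V)$ are GC vector spaces, the twisted product structure on $W\oplus V$ is the direct sum of $\tilde{\mathcal J}_W$ and $\mathcal J_V$. A subspace $U$ of a GC vector space $(X,\mathcal J)$ is generalized isotropic if $\mathcal J(U)\subseteq U\oplus\operatorname{Ann}(U)$. A subspace $W\subseteq V$ equipped with a GC structure $\mathcal J_W$ satisfies the graph condition (with respect to $\mathcal J_W$) if the graph $\{(w,w):w\in W\}\subseteq W\oplus V$ of the inclusion is generalized isotropic for the twisted product structure on $W\oplus V$. *)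

(* Defs.v *)
From HB Require Import structures.
From mathcomp Require Import all_boot all_order all_algebra.
From mathcomp Require Import complex.

Set Implicit Arguments.
Unset Strict Implicit.
Unset Printing Implicit Defensive.

Import Order.TTheory GRing.Theory Num.Theory.
Local Open Scope ring_scope.

(** * Complexification *)

(* The pair (x, y) stands for x + i y. *)
Definition cplx_carrier (R : rcfType) (V : vectType R) : Type := (V * V)%type.

Section Complexification.
Variables (R : rcfType) (V : vectType R).

HB.instance Definition _ := GRing.Zmodule.on (cplx_carrier V).

Definition cplx_scale (a : R[i]) (z : cplx_carrier V) : cplx_carrier V :=
  (complex.Re a *: z.1 - complex.Im a *: z.2,
   complex.Re a *: z.2 + complex.Im a *: z.1).

Fact cplx_scaleA a b z :
  cplx_scale a (cplx_scale b z) = cplx_scale (a * b) z.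
Proof.
case: a b z => [a1 a2] [b1 b2] [x y]; rewrite /cplx_scale /=; congr pair.
  rewrite scalerBr scalerDr scalerBl scalerDl !scalerA !opprD.
  by rewrite [X in _ + X]addrC addrACA.
rewrite scalerBr scalerDr scalerBl scalerDl !scalerA.
by rewrite [X in _ + X]addrC addrACA.
Qed.

Fact cplx_scale1 : left_id 1 cplx_scale.
Proof. by case=> x y; rewrite /cplx_scale /= !scale1r !scale0r subr0 addr0. Qed.

Fact cplx_scaleDr : right_distributive cplx_scale +%R.
Proof.
case=> a1 a2 [x y] [x' y']; rewrite /cplx_scale /=.
by congr (_, _) => /=; rewrite !scalerDr ?opprD addrACA.
Qed.

Fact cplx_scaleDl z : {morph cplx_scale^~ z : a b / a + b}.
Proof.
case: z => x y [a1 a2] [b1 b2]; rewrite /cplx_scale /=.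
by congr (_, _) => /=; rewrite !scalerDl ?opprD addrACA.
Qed.

HB.instance Definition _ := GRing.Zmodule_isLmodule.Build R[i] (cplx_carrier V)
  cplx_scaleA cplx_scale1 cplx_scaleDr cplx_scaleDl.

Import VectorInternalTheory.

Fact cplx_vect_iso : Vector.axiom (dim V) (cplx_carrier V).
Proof.
exists (fun z : cplx_carrier V => \row_j (v2r z.1 0 j +i* v2r z.2 0 j)%C).
  move=> [a1 a2] [x y] [x' y']; apply/rowP=> j; rewrite !mxE /=.
  by rewrite -scaleNr !linearD !linearZ /= !mxE mulNr.
exists (fun u : 'rV[R[i]]_(dim V) => (r2v (\row_j complex.Re (u 0 j)),
                  r2v (\row_j complex.Im (u 0 j)))).
  case=> x y /=; rewrite -[x in RHS]v2rK -[y in RHS]v2rK.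
  by congr (r2v _, r2v _); apply/rowP=> j; rewrite !mxE.
move=> u; apply/rowP=> j; rewrite !mxE /= !r2vK !mxE.
by case: (u 0 j).
Qed.

HB.instance Definition _ := Lmodule_hasFinDim.Build R[i] (cplx_carrier V)
  cplx_vect_iso.

Definition cplx : vectType R[i] := cplx_carrier V.

Definition conjv (z : cplx) : cplx := (z.1, - z.2).

End Complexification.

Section ComplexifiedMap.
Variables (R : rcfType) (U V : vectType R) (g : 'Hom(U, V)).

Definition cplx_map (z : cplx U) : cplx V := (g z.1, g z.2).

Fact cplx_map_is_linear : linear cplx_map.
Proof.
case=> a1 a2 [x y] [x' y']; rewrite /cplx_map /=.
by congr (_, _); rewrite /= -?scaleNr !linearD !linearZ /= ?scaleNr.
Qed.
HB.instance Definition _ := GRing.isLinear.Build R[i] (cplx U) (cplx V) _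
  cplx_map cplx_map_is_linear.

Definition cplx_hom : 'Hom(cplx U, cplx V) := linfun cplx_map.

Lemma cplx_homE z : cplx_hom z = (g z.1, g z.2).
Proof. by rewrite lfunE. Qed.

End ComplexifiedMap.

(** * Generalized complex structures *)

Notation dual V := 'Hom(V, (GRing.regular _)).

Definition dsumv (R : rcfType) (U V : vectType R) : vectType R := (U * V)%type.

Definition gentangent (R : rcfType) (V : vectType R) : vectType R :=
  dsumv V (dual V).

Definition subspace (R : rcfType) (V : vectType R) (W : {vspace V}) :
    vectType R := subvs_of W.

Section Blocks.
Variables (R : rcfType) (U V : vectType R).

Section Block.
Variables (a : 'Hom(U, V)) (b : 'Hom(dual U, V)).
Variables (c : 'Hom(U, dual V)) (d : 'Hom(dual U, dual V)).

Definition block_map (x : gentangent U) : gentangent V :=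
  (a x.1 + b x.2, c x.1 + d x.2).

Fact block_map_is_linear : linear block_map.
Proof.
move=> k [v f] [w h]; rewrite /block_map /= !linearP /=.
by congr (_, _) => /=; rewrite scalerDr addrACA.
Qed.
HB.instance Definition _ := GRing.isLinear.Build R (gentangent U) (gentangent V)
  _ block_map block_map_is_linear.

(* The matrix ((a, b), (c, d)) acting on columns. *)
Definition block : 'Hom(gentangent U, gentangent V) := linfun block_map.

Lemma blockE x : block x = (a x.1 + b x.2, c x.1 + d x.2).
Proof. by rewrite lfunE. Qed.

End Block.
End Blocks.

Section Injections.
Variables (R : rcfType) (A B : vectType R).

Definition inl_map (v : A) : dsumv A B := (v, 0).
Definition inr_map (w : B) : dsumv A B := (0, w).

Fact inl_map_is_linear : linear inl_map.
Proof. by move=> k x y; congr (_, _); rewrite /= scaler0 addr0. Qed.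
HB.instance Definition _ :=
  GRing.isLinear.Build R A (dsumv A B) _ inl_map inl_map_is_linear.

Fact inr_map_is_linear : linear inr_map.
Proof. by move=> k x y; congr (_, _); rewrite /= scaler0 addr0. Qed.
HB.instance Definition _ :=
  GRing.isLinear.Build R B (dsumv A B) _ inr_map inr_map_is_linear.

Definition inlv : 'Hom(A, dsumv A B) := linfun inl_map.
Definition inrv : 'Hom(B, dsumv A B) := linfun inr_map.
Definition fstv : 'Hom(dsumv A B, A) := linfun fst.
Definition sndv : 'Hom(dsumv A B, B) := linfun snd.

Lemma inlvE v : inlv v = (v, 0). Proof. by rewrite lfunE. Qed.
Lemma inrvE w : inrv w = (0, w). Proof. by rewrite lfunE. Qed.
Lemma fstvE x : fstv x = x.1. Proof. by rewrite lfunE. Qed.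
Lemma sndvE x : sndv x = x.2. Proof. by rewrite lfunE. Qed.

End Injections.

Section GCStructures.
Variables (R : rcfType) (V : vectType R).
Implicit Types (J : 'End(gentangent V)) (x y : gentangent V).

Definition pairing x y : R := - (2%:R)^-1 * (x.2 y.1 + y.2 x.1).

Definition gc_structure J : Prop :=
  (forall x y, pairing (J x) (J y) = pairing x y) /\ (forall x, J (J x) = - x).

(* V_C (+) (V_C)^* is represented by the complexification of V (+) V^*,
   f + i g standing for the complex-linear extension to V_C of v |-> f v + i g v. *)
Definition gc_eigenspace J : {vspace cplx (gentangent V)} :=
  passmx.leigenspace (cplx_hom J) 'i%C.

Definition J1 J : 'Hom(V, V) := (fstv V (dual V) \o J \o inlv V (dual V))%VF.
Definition J2 J : 'Hom(dual V, V) := (fstv V (dual V) \o J \o inrv V (dual V))%VF.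
Definition J3 J : 'Hom(V, dual V) := (sndv V (dual V) \o J \o inlv V (dual V))%VF.
Definition J4 J : 'Hom(dual V, dual V) :=
  (sndv V (dual V) \o J \o inrv V (dual V))%VF.

Definition twist J : 'End(gentangent V) := block (J1 J) (- J2 J) (- J3 J) (J4 J).

Definition skew_map (beta : 'Hom(dual V, V)) : Prop :=
  forall f g : dual V, f (beta g) = - g (beta f).

Definition beta_auto (beta : 'Hom(dual V, V)) : 'End(gentangent V) :=
  block \1%VF beta 0 \1%VF.

Definition beta_transform (beta : 'Hom(dual V, V)) J : 'End(gentangent V) :=
  (beta_auto beta \o J \o (beta_auto beta)^-1)%VF.

Definition annihilates (U : {vspace V}) (f : dual V) : Prop :=
  forall u, u \in U -> f u = 0.

Definition gen_isotropic J (U : {vspace V}) : Prop :=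
  forall u, u \in U -> (J (u, 0)).1 \in U /\ annihilates U (J (u, 0)).2.

(* inv_lfun is only a one-sided inverse in general; here it is two-sided. *)
Lemma beta_autoV beta : (beta_auto beta)^-1%VF = beta_auto (- beta).
Proof.
have K x : beta_auto (- beta) (beta_auto beta x) = x.
  case: x => v f; rewrite !blockE /= !(id_lfunE, zero_lfunE, opp_lfunE) !add0r.
  by rewrite addrK.
have K' x : beta_auto beta (beta_auto (- beta) x) = x.
  case: x => v f; rewrite !blockE /= !(id_lfunE, zero_lfunE, opp_lfunE) !add0r.
  by rewrite subrK.
have ker0 : lker (beta_auto beta) == 0%VS.
  by apply/lker0P => x y /(congr1 (beta_auto (- beta))); rewrite !K.
by apply/lfunP=> x; rewrite -[x in LHS]K' (lker0_lfunK ker0).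
Qed.

End GCStructures.

Section DirectSum.
Variables (R : rcfType) (U V : vectType R).
Variables (JU : 'End(gentangent U)) (JV : 'End(gentangent V)).

Definition dsum_map (x : gentangent (dsumv U V)) : gentangent (dsumv U V) :=
  let y := JU (x.1.1, x.2 \o inlv U V)%VF in
  let z := JV (x.1.2, x.2 \o inrv U V)%VF in
  ((y.1, z.1), (y.2 \o fstv U V)%VF + (z.2 \o sndv U V)%VF).

Fact dsum_map_is_linear : linear dsum_map.
Proof.
move=> k x y; rewrite /dsum_map /=.
have E1 : (k *: x.1.1 + y.1.1, ((k *: x.2 + y.2) \o inlv U V)%VF) =
    k *: (x.1.1, (x.2 \o inlv U V)%VF) + (y.1.1, (y.2 \o inlv U V)%VF).
  by congr (_, _); rewrite /= comp_lfunDl -comp_lfunZl.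
have E2 : (k *: x.1.2 + y.1.2, ((k *: x.2 + y.2) \o inrv U V)%VF) =
    k *: (x.1.2, (x.2 \o inrv U V)%VF) + (y.1.2, (y.2 \o inrv U V)%VF).
  by congr (_, _); rewrite /= comp_lfunDl -comp_lfunZl.
rewrite E1 E2 !linearP; congr (_, _) => /=.
by rewrite !comp_lfunDl -!comp_lfunZl scalerDr addrACA.
Qed.
HB.instance Definition _ := GRing.isLinear.Build R (gentangent (dsumv U V))
  (gentangent (dsumv U V)) _ dsum_map dsum_map_is_linear.

Definition dsum : 'End(gentangent (dsumv U V)) := linfun dsum_map.

Lemma dsumE x : dsum x = dsum_map x.
Proof. by rewrite lfunE. Qed.

End DirectSum.

Section GCSubspaces.
Variables (R : rcfType) (V : vectType R) (W : {vspace V}).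
Implicit Types (J : 'End(gentangent V)) (JW : 'End(gentangent (subspace W))).

Definition inclv : 'Hom(subspace W, V) := linfun vsval.

Lemma inclvE w : inclv w = vsval w. Proof. by rewrite lfunE. Qed.

Definition mixed : vectType R := dsumv (subspace W) (dual V).

Definition incl_map (x : mixed) : gentangent V := (inclv x.1, x.2).
Definition restr_map (x : mixed) : gentangent (subspace W) :=
  (x.1, (x.2 \o inclv)%VF).

Fact incl_map_is_linear : linear incl_map.
Proof. by move=> k x y; congr (_, _); rewrite /= linearP. Qed.
HB.instance Definition _ := GRing.isLinear.Build R
  mixed (gentangent V) _ incl_map incl_map_is_linear.

Fact restr_map_is_linear : linear restr_map.
Proof.
by move=> k x y; congr (_, _); rewrite /= comp_lfunDl -comp_lfunZl.
Qed.
HB.instance Definition _ := GRing.isLinear.Build R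
  mixed (gentangent (subspace W)) _
  restr_map restr_map_is_linear.

Definition incl_hom := linfun incl_map.
Definition restr_hom := linfun restr_map.

Lemma incl_homE x : incl_hom x = (vsval x.1, x.2).
Proof. by rewrite lfunE /= /incl_map inclvE. Qed.

Lemma restr_homE x : restr_hom x = (x.1, (x.2 \o inclv)%VF).
Proof. by rewrite lfunE. Qed.

(* E_W: the preimage is E \cap (W_C (+) V_C^* ), the image restricts to W_C. *)
Definition sub_eigenspace (E : {vspace cplx (gentangent V)}) :
    {vspace cplx (gentangent (subspace W))} :=
  (cplx_hom restr_hom @: (cplx_hom incl_hom @^-1: E))%VS.

Lemma mem_sub_eigenspace E y :
  y \in sub_eigenspace E <->
  exists w1 w2 : subspace W, exists f1 f2 : dual V,
    (((vsval w1, f1), (vsval w2, f2)) : cplx (gentangent V)) \in E /\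
    y = ((w1, (f1 \o inclv)%VF), (w2, (f2 \o inclv)%VF)).
Proof.
split.
  move=> /memv_imgP[[[w1 f1] [w2 f2]]].
  rewrite -memv_preim !cplx_homE !incl_homE !restr_homE => Ez ->.
  by exists w1, w2, f1, f2.
move=> [w1 [w2 [f1 [f2 [Ez ->]]]]]; apply/memv_imgP.
exists ((w1, f1), (w2, f2)); last by rewrite cplx_homE !restr_homE.
by rewrite -memv_preim cplx_homE !incl_homE.
Qed.

(* conjv is an involution: conjv z \in E iff z lies in the conjugate of E. *)
Definition gc_subspace J : Prop :=
  forall z, z \in sub_eigenspace (gc_eigenspace J) ->
    conjv z \in sub_eigenspace (gc_eigenspace J) -> z = 0.

Definition induced_gc J JW : Prop :=
  gc_structure JW /\ gc_eigenspace JW = sub_eigenspace (gc_eigenspace J).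

Definition twisted_product JW J : 'End(gentangent (dsumv (subspace W) V)) :=
  dsum (twist JW) J.

Definition diag_map (w : subspace W) : dsumv (subspace W) V := (w, vsval w).

Fact diag_map_is_linear : linear diag_map.
Proof. by move=> k x y; congr (_, _); rewrite /= linearP. Qed.
HB.instance Definition _ := GRing.isLinear.Build R
  (subspace W) (dsumv (subspace W) V) _ diag_map diag_map_is_linear.

Definition incl_graph : {vspace dsumv (subspace W) V} := limg (linfun diag_map).

Definition graph_condition J JW : Prop :=
  gen_isotropic (twisted_product JW J) incl_graph.

End GCSubspaces.

Section Uniqueness.
Variables (R : rcfType) (V : vectType R).
Implicit Types (J : 'End(gentangent V)).

Lemma mem_gc_eigenspace J (z : cplx (gentangent V)) :
  z \in gc_eigenspace J <-> J z.1 = - z.2 /\ J z.2 = z.1.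
Proof.
rewrite memv_ker add_lfunE opp_lfunE scale_lfunE id_lfunE cplx_homE subr_eq0.
have -> : 'i%C *: z = (- z.2, z.1).
  by congr (_, _); rewrite /= scale0r scale1r ?sub0r ?add0r.
by split=> [/eqP[-> ->] //|[-> ->]].
Qed.

(* A generalized complex structure is determined by its +i-eigenspace, so that
   induced_gc J holds of at most one structure on W. *)
Lemma gc_eigenspace_inj J J' : gc_structure J -> gc_structure J' ->
  gc_eigenspace J = gc_eigenspace J' -> J = J'.
Proof.
move=> [_ JJ] _ eqE; apply/lfunP=> x.
have JN y : J (- y) = - J y by rewrite linearN.
have : ((x, - J x) : cplx (gentangent V)) \in gc_eigenspace J.
  apply/mem_gc_eigenspace; split => [|/=]; last by rewrite JN JJ opprK.
  by rewrite opprK.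
by rewrite eqE => /mem_gc_eigenspace[/= -> _]; rewrite opprK.
Qed.

End Uniqueness.

Lemma induced_gc_uniq (R : rcfType) (V : vectType R) (W : {vspace V})
    (J : 'End(gentangent V)) (JW JW' : 'End(gentangent (subspace W))) :
  induced_gc J JW -> induced_gc J JW' -> JW = JW'.
Proof.
move=> [gcJW EJW] [gcJW' EJW'].
by apply: (gc_eigenspace_inj gcJW gcJW'); rewrite EJW EJW'.
Qed.

(* Main.v *)
(* The graph condition says exactly that J (w, 0) restricts to JW (w, 0) on W
   for every w in W, with the vector part of J (w, 0) already in W. Let D be the
   set of x in W + V^* with J x in W + V^*. If W is a GC subspace, then J
   descends along the restriction D -> W + W^* to the induced structure, which
   therefore agrees with JW on W; surjectivity of the restriction on D follows
   from the invariance of W under J1 and the skewness of J2. Two GC structures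
   on W which agree on W differ by a beta-field transform. *)
From HB Require Import structures.
Require Import Defs.
From mathcomp Require Import all_boot all_order all_algebra.
From mathcomp Require Import reals complex.

Set Implicit Arguments.
Unset Strict Implicit.
Unset Printing Implicit Defensive.

Import Order.TTheory GRing.Theory Num.Theory.
Local Open Scope ring_scope.

Lemma dual_separates (R : rcfType) (V : vectType R) (v : V) :
  (forall f : dual V, f v = 0) -> v = 0.
Proof.
move=> fv0; rewrite (coord_vbasis (memvf v)) big1 // => i _.
(* [coord] has values in [R]; it is retyped over [R^o] so that it can be packed as an element of the
   dual. *)
pose c : V -> R^o := coord (vbasis fullv) i.
have lin_c : linear c by move=> a x y; rewrite /c linearP.
pose lc := GRing.isLinear.Build R V R^o _ c lin_c.
pose cL : {linear V -> R^o} := HB.pack c lc.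
by have := fv0 (linfun cL); rewrite lfunE /= /c => ->; rewrite scale0r.
Qed.

(** * Skewness of GC structures, and structures that agree on vectors *)

Section GCStructure.
Variables (R : rcfType) (V : vectType R).
Implicit Types (J : 'End(gentangent V)) (x y : gentangent V).

Lemma gentangentD x y : x + y = (x.1 + y.1, x.2 + y.2). Proof. by []. Qed.

Lemma pairingC x y : pairing x y = pairing y x.
Proof. by rewrite /pairing addrC. Qed.

Lemma pairingNr x y : pairing x (- y) = - pairing x y.
Proof. by rewrite /pairing /= opp_lfunE linearN -mulrN opprD. Qed.

Lemma pairingDr x y z : pairing x (y + z) = pairing x y + pairing x z.
Proof. by rewrite /pairing /= add_lfunE linearD -mulrDr addrACA. Qed.

Lemma pairingE x y : x.2 y.1 + y.2 x.1 = - 2%:R * pairing x y.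
Proof. by rewrite /pairing mulrA mulrNN mulfV ?mul1r // pnatr_eq0. Qed.

Lemma dual_pairingE (f : dual V) x : f x.1 = - 2%:R * pairing (0, f) x.
Proof. by rewrite -pairingE linear0 addr0. Qed.

(** Orthogonality applied to [x] and [- J y], since [J (- J y) = y]. *)
Lemma gc_skew J x y : gc_structure J ->
  pairing (J x) y = - pairing x (J y).
Proof.
by move=> [orth JJ]; rewrite -pairingNr -[in RHS]orth linearN /= JJ opprK.
Qed.

(* Writing K for the difference of the two structures, K anticommutes with J,
   and K and J K are both strictly block upper triangular; conjugation of J
   by 1 + J K / 2 then adds exactly K. *)
Lemma beta_transform_of_agree J J' : gc_structure J -> gc_structure J' ->
    (forall v, J' (v, 0) = J (v, 0)) ->
  exists beta, skew_map beta /\ J' = beta_transform beta J.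
Proof.
move=> gcJ gcJ' eqJ.
pose K := J' - J.
have KE x : K x = J' x - J x by rewrite add_lfunE opp_lfunE.
have Kv v : K (v, 0) = 0 by rewrite KE eqJ subrr.
have Kskew x y : pairing (K x) y = - pairing x (K y).
  rewrite !KE pairingC !pairingDr !pairingNr !(pairingC y) (gc_skew _ _ gcJ).
  by rewrite (gc_skew _ _ gcJ') !opprD !opprK.
(* [K] is skew and kills vectors, so [K x] pairs to zero with every vector. *)
have K2 x : (K x).2 = 0.
  apply/lfunP=> v; rewrite zero_lfunE.
  have := pairingE (K x) (v, 0); rewrite Kskew Kv /= zero_lfunE addr0 => ->.
  by rewrite /pairing /= linear0 zero_lfunE addr0 mulr0 oppr0 mulr0.
have Kx1 x : K x = ((K x).1, 0) by rewrite -(K2 x) -surjective_pairing.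
have KK x : K (K x) = 0 by rewrite [X in K X]Kx1 Kv.
(* Both structures square to -1 and [K] squares to 0, so expanding the square of [K + J] leaves only
   the cross terms. *)
have KJ x : K (J x) = - J (K x).
  have J'E y : J' y = K y + J y by rewrite KE subrK.
  have : J' (J' x) = J (J x) by rewrite gcJ.2 gcJ'.2.
  rewrite !J'E !linearD /= KK add0r addrA -[RHS]add0r => /addIr/eqP.
  by rewrite addr_eq0 => /eqP.
have JK2 x : (J (K x)).2 = 0 by rewrite -[J (K x)]opprK -KJ /= K2 oppr0.
have J'E x : J' x = J x + K x by rewrite KE addrC subrK.
have KvD v f : K (v, f) = K (0, f).
  have -> : (v, f) = ((v, 0) : gentangent V) + (0, f).
    by rewrite gentangentD /= addr0 add0r.
  by rewrite linearD /= Kv add0r.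
pose beta : 'Hom(dual V, V) :=
  2%:R^-1 *: (fstv V (dual V) \o J \o K \o inrv V (dual V))%VF.
have betaE v f : (beta f, 0) = 2%:R^-1 *: J (K (v, f)).
  rewrite KvD scale_lfunE !comp_lfunE /= fstvE inrvE.
  by rewrite [RHS]surjective_pairing /= JK2 scaler0.
(* The scalar [c] is 1 for the automorphism and -1 for its inverse. *)
have autoE (c : R) x : beta_auto (c *: beta) x = x + (c / 2%:R) *: J (K x).
  case: x => v f; rewrite blockE !id_lfunE zero_lfunE scale_lfunE add0r.
  by rewrite -scalerA -betaE gentangentD /= scaler0 addr0.
exists beta; split=> [f g|].
  have -> : beta g = (2%:R^-1 *: J (K (0, g))).1 by rewrite -betaE.
  have -> : beta f = (2%:R^-1 *: J (K (0, f))).1 by rewrite -betaE.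
  have JKskew x y : pairing x (J (K y)) = - pairing y (J (K x)).
    by rewrite pairingC (gc_skew _ _ gcJ) Kskew opprK KJ pairingNr.
  by rewrite /= !linearZ /= !dual_pairingE JKskew mulrN scalerN.
(* Each of the two outer factors contributes [K x / 2]; the term quadratic in [K] vanishes. *)
rewrite /beta_transform beta_autoV; apply/lfunP=> x.
rewrite !comp_lfunE /= -scaleN1r -[X in beta_auto X](scale1r beta) !autoE.
rewrite !linearD !linearZ /= gcJ.2 KJ.
rewrite [J (- _)]linearN [K (- _)]linearN /= KK gcJ.2.
rewrite !(oppr0, opprK, scaler0, addr0) linear0 !scaler0 addr0.
by rewrite mulNr scaleNr scalerN opprK -addrA -scalerDl -splitr scale1r.
Qed.

End GCStructure.

(** * Transposes and factorisation of linear maps *)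

Section Precomposition.
Variables (R : rcfType) (U V : vectType R) (g : 'Hom(U, V)).

Definition precomp_map (f : dual V) : dual U := (f \o g)%VF.

Fact precomp_map_is_linear : linear precomp_map.
Proof. by move=> k f h; rewrite /precomp_map comp_lfunDl -comp_lfunZl. Qed.
HB.instance Definition _ := GRing.isLinear.Build R (dual V) (dual U) _
  precomp_map precomp_map_is_linear.

Definition precomp : 'Hom(dual V, dual U) := linfun precomp_map.

Lemma precompE f : precomp f = (f \o g)%VF. Proof. by rewrite lfunE. Qed.

End Precomposition.

(** The partial inverse satisfies [A (A^-1 (A x)) = A x], so [x] and [A^-1 (A x)] differ by an
    element of [lker A], which [B] kills. *)
Lemma lfun_factor (K : fieldType) (aT bT cT : vectType K) (A : 'Hom(aT, bT))
    (B : 'Hom(aT, cT)) :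
  (lker A <= lker B)%VS -> exists X : 'Hom(bT, cT), B = (X \o A)%VF.
Proof.
move=> /subvP sAB; exists (B \o A^-1)%VF; apply/lfunP=> x.
rewrite !comp_lfunE; apply/eqP; rewrite -subr_eq0 -linearB -memv_ker sAB //.
by rewrite memv_ker linearB /= limg_lfunVK ?memv_img ?memvf // subrr.
Qed.

(** * The structure induced on a GC subspace *)

Section InducedStructure.
Variables (R : rcfType) (V : vectType R) (W : {vspace V}).
Variable J : 'End(gentangent V).

Definition vsprojv : 'Hom(V, subspace W) := linfun (vsproj W).

Lemma vsprojvE v : vsprojv v = vsproj W v. Proof. by rewrite lfunE. Qed.

(** A version of [restr_map] defined on the whole of [gentangent V], so that it composes with [J];
    projecting the vector part changes nothing when that part lies in [W]. *)
Definition restrict : 'Hom(gentangent V, gentangent (subspace W)) :=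
  block vsprojv 0 0 (precomp (inclv W)).

Lemma restrictE x : restrict x = (vsproj W x.1, (x.2 \o inclv W)%VF).
Proof.
by rewrite blockE !zero_lfunE addr0 add0r vsprojvE precompE.
Qed.

Lemma pairing_restrict x y : x.1 \in W -> y.1 \in W ->
  pairing (restrict x) (restrict y) = pairing x y.
Proof.
move=> Wx Wy; rewrite !restrictE /pairing /= !comp_lfunE !inclvE.
by rewrite !vsprojK.
Qed.

Hypothesis gcJ : gc_structure J.

(** An element of [gc_eigenspace J] with real part [x] is [x - i J x], so real vectors parametrise
    the eigenspace. *)
Lemma sub_eigenspaceP (z : cplx (gentangent (subspace W))) :
  z \in sub_eigenspace W (gc_eigenspace J) <->
  exists x, [/\ x.1 \in W, (J x).1 \in W & z = (restrict x, - restrict (J x))].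
Proof.
split=> [/mem_sub_eigenspace[w1 [w2 [f1 [f2 [/mem_gc_eigenspace[/= e1 _] ->]]]]]|].
  exists (vsval w1, f1); rewrite e1 [restrict (- _)]linearN /= opprK !restrictE /= !vsvalK.
  by split; rewrite ?rpredN ?subvsP.
case=> x [Wx WJx ->]; apply/mem_sub_eigenspace.
exists (vsproj W x.1), (vsproj W (- (J x).1)), x.2, (- (J x).2).
split; last by rewrite -linearN /= !restrictE.
apply/mem_gc_eigenspace; rewrite /= !vsprojK ?rpredN //.
rewrite -!surjective_pairing.
have -> : (- (J x).1, - (J x).2) = - J x by [].
by rewrite [J (- _)]linearN /= gcJ.2 !opprK.
Qed.

Hypothesis gcW : gc_subspace W J.

(** The element of [sub_eigenspace] coming from [x] is purely imaginary, so its conjugate is its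
    negative and lies there too. This makes [J] descend along [restrict]. *)
Lemma gc_subspace_ann x :
  restrict x = 0 -> x.1 \in W -> (J x).1 \in W -> restrict (J x) = 0.
Proof.
move=> rx0 Wx WJx; pose z : cplx (gentangent (subspace W)) := (0, - restrict (J x)).
have Ez : z \in sub_eigenspace W (gc_eigenspace J).
  by apply/sub_eigenspaceP; exists x; rewrite rx0.
have /(congr1 snd)/= : z = 0.
  apply: gcW => //; have -> : conjv z = - z by congr (_, _); rewrite /= oppr0.
  by rewrite rpredN.
by move/eqP; rewrite oppr_eq0 => /eqP.
Qed.

Hypothesis stabW : forall w, w \in W -> (J (w, 0)).1 \in W.

(* Let P project V along W. By gc_subspace_ann, P J2 P^* and J2 P^* have the
   same kernel, so J2 P^* factors as X P J2 P^*; as J2 is skew, the transpose of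
   this factorisation shows which element of Ann W corrects an extension. *)
Lemma gc_subspace_extension : exists ext : 'Hom(dual (subspace W), dual V),
  forall f, (ext f \o inclv W)%VF = f /\ (J (0, ext f)).1 \in W.
Proof.
have [P PE] : exists P : 'End(V), forall v, P v = v - projv W v.
  by exists (\1%VF - projv W) => v; rewrite add_lfunE opp_lfunE id_lfunE.
have PW v : v \in W -> P v = 0 by move=> Wv; rewrite PE projv_id ?subrr.
have WP v : P v = 0 -> v \in W.
  by rewrite PE => /eqP; rewrite subr_eq0 => /eqP ->; rewrite memv_proj.
pose B : 'Hom(dual V, V) := (J2 J \o precomp P)%VF.
have J2E f : J2 J f = (J (0, f)).1 by rewrite !comp_lfunE fstvE inrvE.
have BE h : B h = (J (0, (h \o P)%VF)).1 by rewrite comp_lfunE precompE J2E.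
have J2skew (f h : dual V) : f (J (0, h)).1 = - h (J (0, f)).1.
  by rewrite !dual_pairingE pairingC (gc_skew _ _ gcJ) mulrN.
have [|X defB] := @lfun_factor _ _ _ _ (P \o B)%VF B.
  apply/subvP=> h; rewrite !memv_ker comp_lfunE => /eqP/WP; rewrite BE => WB.
  have /(congr1 fst) : restrict (J (0, (h \o P)%VF)) = 0.
    apply: gc_subspace_ann; rewrite ?mem0v // restrictE linear0; congr (_, _).
    apply/lfunP=> w; rewrite !comp_lfunE inclvE PW ?subvsP // linear0.
    by rewrite zero_lfunE.
  by rewrite restrictE => /(congr1 vsval); rewrite /= vsprojK // => ->.
exists (precomp vsprojv - (precomp P \o precomp X \o precomp vsprojv))%VF => f.
have extE v : (precomp vsprojv - (precomp P \o precomp X \o precomp vsprojv))%VF f v =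
    f (vsproj W (v - X (P v))).
  rewrite !(add_lfunE, opp_lfunE) !comp_lfunE !precompE !comp_lfunE !vsprojvE.
  by rewrite -!linearB.
split.
  apply/lfunP=> w; rewrite comp_lfunE extE inclvE PW ?subvsP // linear0 subr0.
  by rewrite vsvalK.
(* Skewness turns the value of [h \o P] on this vector into minus the value of [ext f] on [B h],
   which vanishes because [B = X \o P \o B]. *)
apply: WP; apply: dual_separates => h.
by rewrite -comp_lfunE J2skew extE -BE {1}defB !comp_lfunE subrr !linear0.
Qed.

Lemma gc_subspace_induced : exists Jind : 'End(gentangent (subspace W)),
  induced_gc J Jind /\
  forall x, x.1 \in W -> (J x).1 \in W -> Jind (restrict x) = restrict (J x).
Proof.
have [ext extP] := gc_subspace_extension.
pose lift : 'Hom(gentangent (subspace W), gentangent V) := block (inclv W) 0 0 ext.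
have liftE y : lift y = (vsval y.1, ext y.2).
  by rewrite blockE !zero_lfunE addr0 add0r inclvE.
have liftW y : (lift y).1 \in W by rewrite liftE subvsP.
have JliftW y : (J (lift y)).1 \in W.
  have -> : lift y = (vsval y.1, 0) + (0, ext y.2).
    by rewrite liftE gentangentD /= addr0 add0r.
  by rewrite linearD /= rpredD ?stabW ?subvsP ?(extP _).2.
have liftK y : restrict (lift y) = y.
  by rewrite restrictE liftE /= vsvalK (extP _).1 -surjective_pairing.
pose Jind := (restrict \o J \o lift)%VF.
(* Independence of the lift: [x] and [lift (restrict x)] differ by an element to which
   [gc_subspace_ann] applies. All properties of [J] then transfer to [Jind]. *)
have JindE x : x.1 \in W -> (J x).1 \in W -> Jind (restrict x) = restrict (J x).
  move=> Wx WJx; rewrite !comp_lfunE /=; apply/eqP.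
  rewrite -subr_eq0 -!linearB /=; apply/eqP; apply: gc_subspace_ann.
  - by rewrite linearB /= liftK subrr.
  - by rewrite rpredB.
  - by rewrite linearB /= rpredB.
have J2 x : J (J x) = - x by exact: gcJ.2.
exists Jind; split=> //; split; first split.
- move=> x y; rewrite -[x]liftK -[y]liftK !JindE // !pairing_restrict //.
  exact: gcJ.1.
- move=> x; rewrite -[x]liftK !JindE ?J2 ?rpredN //.
  by rewrite linearN.
apply/vspaceP=> z; apply/idP/idP.
  case: z => z1 z2 /mem_gc_eigenspace[/= e1 _]; apply/sub_eigenspaceP.
  by exists (lift z1); split=> //; rewrite -JindE // liftK e1 opprK.
case/sub_eigenspaceP=> x [Wx WJx ->]; apply/mem_gc_eigenspace; split=> /=.
  by rewrite JindE // opprK.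
by rewrite linearN /= JindE ?J2 ?rpredN // linearN opprK.
Qed.

End InducedStructure.

(** The twist negates the covector part of [JW (w, 0)], so annihilating the graph means that the two
    covectors agree on [W]; the vector parts agree by membership in the graph. *)
Lemma graph_conditionP (R : rcfType) (V : vectType R) (W : {vspace V})
    (J : 'End(gentangent V)) (JW : 'End(gentangent (subspace W))) :
  graph_condition J JW <->
  forall w, (J (vsval w, 0)).1 \in W /\ JW (w, 0) = restrict W (J (vsval w, 0)).
Proof.
have twE w : twisted_product JW J ((w, vsval w), 0) =
    (((JW (w, 0)).1, (J (vsval w, 0)).1),
     (- ((JW (w, 0)).2 \o fstv _ _) + ((J (vsval w, 0)).2 \o sndv _ _))%VF).
  rewrite dsumE /dsum_map /= !comp_lfun0l blockE !(opp_lfunE, linear0) !addr0.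
  rewrite /J1 /J3 !comp_lfunE fstvE sndvE inlvE.
  by rewrite /= comp_lfunNl.
have memG u : u \in incl_graph W <-> u.2 = vsval u.1.
  split=> [/memv_imgP[w _ ->]|]; first by rewrite lfunE.
  case: u => w v /= ->; apply/memv_imgP; exists w; first exact: memvf.
  by rewrite lfunE.
have annE w u : (- ((JW (w, 0)).2 \o fstv _ _) +
    ((J (vsval w, 0)).2 \o sndv _ _))%VF (u, vsval u) =
    (J (vsval w, 0)).2 (inclv W u) - (JW (w, 0)).2 u.
  by rewrite add_lfunE opp_lfunE !comp_lfunE fstvE sndvE inclvE addrC.
split=> [isoG w|eqJ [w v] /memG/= ->].
  have /isoG : ((w, vsval w) : dsumv (subspace W) V) \in incl_graph W by apply/memG.
  rewrite twE => -[/memG/= eJ1 ann]; rewrite eJ1 subvsP; split=> //.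
  rewrite restrictE eJ1 vsvalK [LHS]surjective_pairing; congr (_, _).
  apply/lfunP=> u; apply/eqP; rewrite comp_lfunE eq_sym -subr_eq0 -annE.
  by apply/eqP/ann/memG.
rewrite twE; split.
  by apply/memG; rewrite /= (eqJ w).2 restrictE /= vsprojK // (eqJ w).1.
move=> [u v'] /memG/= ->; rewrite annE (eqJ w).2 restrictE /= comp_lfunE.
by rewrite subrr.
Qed.

Theorem theorem3 (R : realType) (V : vectType R) (J : 'End(gentangent V))
    (W : {vspace V}) (JW : 'End(gentangent (subspace W))) :
  gc_structure J ->
  gc_structure JW ->
  graph_condition J JW ->
  gc_subspace W J ->
  exists Jind : 'End(gentangent (subspace W)),
    induced_gc J Jind /\
    graph_condition J Jind /\
    exists beta : 'Hom(dual (subspace W), subspace W),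
      skew_map beta /\ JW = beta_transform beta Jind.
Proof.
move=> gcJ gcJW /graph_conditionP graphJW gcW.
have stabW w : w \in W -> (J (w, 0)).1 \in W.
  by move=> Ww; have [] := graphJW (vsproj W w); rewrite vsprojK.
have [Jind [indJ JindE]] := gc_subspace_induced gcJ gcW stabW.
(* By [stabW], [(vsval w, 0)] is an admissible lift of [(w, 0)]; hence [Jind] and [JW] agree on
   vectors. *)
have JindW w : Jind (w, 0) = restrict W (J (vsval w, 0)).
  rewrite -JindE ?subvsP ?stabW ?subvsP // restrictE /= vsvalK.
  by rewrite comp_lfun0l.
exists Jind; split=> //; split.
  by apply/graph_conditionP => w; split; [exact: (graphJW w).1 | exact: JindW].
apply: beta_transform_of_agree => // [|w]; first exact: indJ.1.
by rewrite JindW (graphJW w).2.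
Qed.
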